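(* Let $\{X_i\}_{i\in J}$ be a family of real or complex Banach spaces. Let $(x_i)\in \left(\bigoplus_{i\in J}X_i\right)_{c_0}$ with $\|(x_i)\|=1$ and let $\Lambda=\{i\in J:\|x_i\|=1\}$. Then $S_{(x_i)}$ is weakly compact if and only if $S_{x_i}$ is weakly compact for each $i\in\Lambda$.
   Context: $\left(\bigoplus_{i\in J}X_i\right)_{c_0}$ is the $c_0$-direct sum: the space of families $(x_i)_{i\in J}$ with $x_i\in X_i$ and $\|x_i\|\to 0$ (i.e. for every $\epsilon>0$ the set $\{i:\|x_i\|\ge\epsilon\}$ is finite), with norm $\|(x_i)\|=\sup_{i\in J}\|x_i\|$. For a Banach space $E$ with unit sphere $S(E)$ and $e\in S(E)$, the state space of $e$ is $S_e=\{e^*\in S(E^* ):e^*(e)=1\}\subseteq E^*$; $S_{(x_i)}$ is taken with $E$ the $c_0$-direct sum and $S_{x_i}$ with $E=X_i$. Weakly compact means compact in the weak topology $\sigma(E^*,E^{**})$ of the corresponding dual space. *)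

(* Defs.v *)
From HB Require Import structures.
From mathcomp Require Import all_boot all_order all_algebra.
From mathcomp Require Import all_classical all_reals all_analysis.
From mathcomp Require Import complex.

Set Implicit Arguments.
Unset Strict Implicit.
Unset Printing Implicit Defensive.

Import Order.TTheory GRing.Theory Num.Theory.
Import numFieldNormedType.Exports.

Local Open Scope classical_set_scope.
Local Open Scope ring_scope.

Variant scalar_kind := RealScalars | ComplexScalars.

Definition scalar_field (R : realType) (k : scalar_kind) : numFieldType :=
  match k with RealScalars => R | ComplexScalars => complex R end.

Section C0Sum.
Context {K : numFieldType} {J : Type} (X : J -> completeNormedModType K).

Definition vanishing (x : forall i, X i) : Prop :=
  forall e : K, 0 < e -> finite_set [set i | e <= `|x i|].

Record c0_sum := C0Sum {
  c0_fun :> forall i, X i;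
  c0_vanishing : vanishing c0_fun }.

Implicit Types x y z : c0_sum.

Lemma c0_eqP x y : (forall i, x i = y i) -> x = y.
Proof.
case: x y => [x hx] [y hy] /= xy.
have e : x = y by apply: functional_extensionality_dep.
by move: hx; rewrite e => hx; congr C0Sum; exact: Prop_irrelevance.
Qed.

HB.instance Definition _ := gen_eqMixin c0_sum.
HB.instance Definition _ := gen_choiceMixin c0_sum.

Lemma vanishing0 : vanishing (fun=> 0).
Proof.
move=> e e0; apply: (@sub_finite_set _ _ set0) => // i /=.
by rewrite normr0 lt_geF.
Qed.

Lemma vanishingN x : vanishing (fun i => - x i).
Proof.
move=> e e0; apply: sub_finite_set (c0_vanishing x e0) => i /=.
by rewrite normrN.
Qed.

Lemma vanishingD x y : vanishing (fun i => x i + y i).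
Proof.
move=> e e0; have e20 : 0 < e / 2 by rewrite divr_gt0.
apply: (@sub_finite_set _ _
  ([set i | e / 2 <= `|x i|] `|` [set i | e / 2 <= `|y i|])); last first.
  by rewrite finite_setU; split; exact: c0_vanishing.
move=> i /= exy.
have rx : `|x i| \is Num.real by exact: normr_real.
have ry : `|y i| \is Num.real by exact: normr_real.
have re : e / 2 \is Num.real by exact: gtr0_real.
case: (real_leP re rx) => [|xe]; first by left.
case: (real_leP re ry) => [|ye]; first by right.
have := le_lt_trans exy (le_lt_trans (ler_normD (x i) (y i)) (ltrD xe ye)).
by rewrite -splitr ltxx.
Qed.

Lemma vanishingZ (a : K) x : vanishing (fun i => a *: x i).
Proof.
move=> e e0; have [->|a0] := eqVneq a 0.
  apply: (@sub_finite_set _ _ set0) => // i /=.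
  by rewrite scale0r normr0 lt_geF.
have na0 : 0 < `|a| by rewrite normr_gt0.
apply: sub_finite_set (c0_vanishing x (divr_gt0 e0 na0)) => i /=.
by rewrite normrZ ler_pdivrMr// mulrC.
Qed.

Definition c0_zero := C0Sum vanishing0.
Definition c0_opp x := C0Sum (vanishingN x).
Definition c0_add x y := C0Sum (vanishingD x y).
Definition c0_scale (a : K) x := C0Sum (vanishingZ a x).

Lemma c0_addA : associative c0_add.
Proof. by move=> x y z; apply: c0_eqP => i /=; rewrite addrA. Qed.

Lemma c0_addC : commutative c0_add.
Proof. by move=> x y; apply: c0_eqP => i /=; rewrite addrC. Qed.

Lemma c0_add0 : left_id c0_zero c0_add.
Proof. by move=> x; apply: c0_eqP => i /=; rewrite add0r. Qed.

Lemma c0_addN : left_inverse c0_zero c0_opp c0_add.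
Proof. by move=> x; apply: c0_eqP => i /=; rewrite addNr. Qed.

HB.instance Definition _ :=
  GRing.isZmodule.Build c0_sum c0_addA c0_addC c0_add0 c0_addN.

Lemma c0_scaleA (a b : K) x : c0_scale a (c0_scale b x) = c0_scale (a * b) x.
Proof. by apply: c0_eqP => i /=; rewrite scalerA. Qed.

Lemma c0_scale1 : left_id 1 c0_scale.
Proof. by move=> x; apply: c0_eqP => i /=; rewrite scale1r. Qed.

Lemma c0_scaleDr : right_distributive c0_scale +%R.
Proof. by move=> a x y; apply: c0_eqP => i /=; rewrite scalerDr. Qed.

Lemma c0_scaleDl x : {morph c0_scale^~ x : a b / a + b}.
Proof. by move=> a b; apply: c0_eqP => i /=; rewrite scalerDl. Qed.

HB.instance Definition _ := GRing.Zmodule_isLmodule.Build K c0_sum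
  c0_scaleA c0_scale1 c0_scaleDr c0_scaleDl.

(* The supremum exists in any numFieldType because it is attained; when J is
   empty it takes the default value 0. *)
Definition c0_norm x : K := supremum 0 (range (fun i => `|x i|)).

Lemma c0_norm_lub x (i0 : J) : isLub (range (fun i => `|x i|)) (c0_norm x).
Proof.
suff [m m_ub m_le] : exists2 m, ubound (range (fun i => `|x i|)) m &
    forall b, ubound (range (fun i => `|x i|)) b -> m <= b.
  have xm : supremums (range (fun i => `|x i|)) m by split.
  have ne : range (fun i => `|x i|) !=set0 by exists `|x i0|; exists i0.
  rewrite /c0_norm /supremum; case: ifPn => [/eqP e0|_].
    by move: ne; rewrite e0 => -[].
  by case: xgetP => [y -> [? ?]|/(_ m)/(_ xm)//]; split.
have [x0|/existsNP[i1 /eqP xi1]] := pselect (forall i, x i = 0).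
  exists 0; first by move=> _ [i _ <-]; rewrite x0 normr0.
  by move=> b xb; rewrite -(normr0 (X i0)) -(x0 i0); apply: xb; exists i0.
have e0 : 0 < `|x i1| by rewrite normr_gt0.
have := c0_vanishing x e0.
set A := [set i | _] => finA.
have A1 : A i1 by rewrite /A /=.
suff [i2 A2 x2] : exists2 i2, A i2 & forall i, A i -> `|x i| <= `|x i2|.
  exists `|x i2|; last by move=> b; apply; exists i2.
  move=> _ [i _ <-]; have [/x2//|nAi] := pselect (A i).
  apply: le_trans A2; move/negP: nAi.
  by rewrite -real_ltNge ?normr_real//; exact: ltW.
have [l Al] : exists l : seq {classic J}, A = [set` l] by apply/finite_seqP.
have : exists2 i, A i & forall j, j \in l -> `|x j| <= `|x i|.
  have : forall j, j \in l -> A j by move=> j; rewrite Al.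
  elim: l {Al} => [|a l ih] lA; first by exists i1.
  have [|i Ai hi] := ih; first by move=> j jl; apply: lA; rewrite inE jl orbT.
  have ra : `|x a| \is Num.real by exact: normr_real.
  have ri : `|x i| \is Num.real by exact: normr_real.
  case: (real_leP ra ri) => [ai|/ltW ia].
    by exists i => // j; rewrite inE => /predU1P[->//|/hi].
  exists a; first by apply: lA; rewrite mem_head.
  move=> j; rewrite inE => /predU1P[->//|/hi]; by move/le_trans; apply.
by move=> [i Ai hi]; exists i => // j; rewrite {1}Al; exact: hi.
Qed.

Lemma c0_norm_ge x i : `|x i| <= c0_norm x.
Proof. by have [h _] := c0_norm_lub x i; apply: h; exists i. Qed.

Lemma c0_norm_le x (b : K) :
  0 <= b -> (forall i, `|x i| <= b) -> c0_norm x <= b.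
Proof.
move=> b0 xb; have [[i0]|nJ] := pselect (inhabited J).
  by have [_] := c0_norm_lub x i0; apply=> _ [i _ <-].
rewrite /c0_norm /supremum; case: ifPn => // /set0P[_ [i _ _]].
by case: nJ.
Qed.

Lemma c0_norm_ge0 x : 0 <= c0_norm x.
Proof.
have [[i0]|nJ] := pselect (inhabited J).
  exact: le_trans (normr_ge0 _) (c0_norm_ge x i0).
rewrite /c0_norm /supremum; case: ifPn => // /set0P[_ [i _ _]].
by case: nJ.
Qed.

Lemma c0_normD x y : c0_norm (x + y) <= c0_norm x + c0_norm y.
Proof.
apply: c0_norm_le => [|i]; first by rewrite addr_ge0 ?c0_norm_ge0.
by rewrite (le_trans (ler_normD _ _))// lerD ?c0_norm_ge.
Qed.

Lemma c0_normZ_le (a : K) x : c0_norm (a *: x) <= `|a| * c0_norm x.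
Proof.
apply: c0_norm_le => [|i]; first by rewrite mulr_ge0 ?c0_norm_ge0.
by rewrite [_ i]/= normrZ ler_wpM2l ?c0_norm_ge.
Qed.

Lemma c0_normr0_eq0 x : c0_norm x = 0 -> x = 0.
Proof.
move=> x0; apply: c0_eqP => i /=; apply/eqP.
by rewrite -normr_le0 -x0 c0_norm_ge.
Qed.

Lemma c0_normZ (a : K) x : c0_norm (a *: x) = `|a| * c0_norm x.
Proof.
apply/eqP; rewrite eq_le c0_normZ_le /=.
have [->|a0] := eqVneq a 0; first by rewrite normr0 mul0r c0_norm_ge0.
have na0 : 0 < `|a| by rewrite normr_gt0.
rewrite mulrC -ler_pdivlMr// mulrC -normfV.
by have := c0_normZ_le a^-1 (a *: x); rewrite scalerA mulVf// scale1r.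
Qed.

HB.instance Definition _ := Lmodule_isNormed.Build K c0_sum
  c0_normD c0_normZ c0_normr0_eq0.

End C0Sum.

(* Completeness of the real numbers, transported to scalar_field R k, whose order is
   partial in the complex case. *)
Lemma scalar_supremums (R : realType) (k : scalar_kind)
    (A : set (scalar_field R k)) :
  A !=set0 -> A `<=` [set a | 0 <= a] -> ubound A !=set0 ->
  supremums A !=set0.
Proof.
case: k A => /= A A0 Age [b Ab].
  exists (reals.sup A); split; first by apply: sup_upper_bound; split=> //; exists b.
  by move=> c Ac; exact: ge_sup.
have AIm a : A a -> a = (complex.Re a)%:C%C.
  by move=> /Age; rewrite /= lecE => /andP[/eqP]; case: a => a a' /= ->.
have [a0 Aa0] := A0.
pose B := [set complex.Re a | a in A].
have hB : has_sup B.
  split; first by exists (complex.Re a0); exists a0.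
  by exists (complex.Re b) => _ [a Aa <-]; have := Ab _ Aa; rewrite lecE => /andP[].
exists ((reals.sup B)%:C)%C; split.
  move=> a Aa; rewrite [a]AIm// lecR.
  by apply: sup_upper_bound => //; exists a.
move=> c Ac; rewrite lecE /=; apply/andP; split.
  by have := Ac _ Aa0; rewrite [a0]AIm// lecE => /andP[].
apply: ge_sup; first exact: hB.1.
by move=> _ [a Aa <-]; have := Ac _ Aa; rewrite lecE => /andP[].
Qed.

Section Dual.
Context {R : realType} {k : scalar_kind}.
Notation K := (scalar_field R k).
Variable E : normedModType K.

Record dual := Dual {
  dual_fun :> E -> K^o;
  dual_linear : linear dual_fun;
  dual_continuous : continuous dual_fun }.

HB.instance Definition _ (f : dual) :=
  GRing.isLinear.Build K E K^o *:%R (dual_fun f) (dual_linear f).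

Implicit Types f g h : dual.

Lemma dual_eqP f g : (forall x, f x = g x) -> f = g.
Proof.
case: f g => [f lf cf] [g lg cg] /= fg.
have e : f = g by apply: funext.
move: lf cf; rewrite e => lf cf.
by congr Dual; exact: Prop_irrelevance.
Qed.

HB.instance Definition _ := gen_eqMixin dual.
HB.instance Definition _ := gen_choiceMixin dual.

Definition dual_zero : dual.
Proof.
exists (fun=> 0); last exact: cst_continuous.
by move=> a x y; rewrite scaler0 addr0.
Defined.

Definition dual_opp f : dual.
Proof.
exists (fun x => - f x) => [a x y|x].
  by rewrite linearP opprD scalerN.
by apply: cvgN; exact: dual_continuous.
Defined.

Definition dual_add f g : dual.
Proof.
exists (fun x => f x + g x) => [a x y|x].
  by rewrite !linearP scalerDr addrACA.
by apply: cvgD; exact: dual_continuous.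
Defined.

Definition dual_scale (a : K) f : dual.
Proof.
exists (fun x => a *: f x) => [b x y|x].
  by rewrite linearP scalerDr !scalerA mulrC.
by apply: cvgZr; exact: dual_continuous.
Defined.

Lemma dual_addA : associative dual_add.
Proof. by move=> f g h; apply: dual_eqP => x /=; rewrite addrA. Qed.

Lemma dual_addC : commutative dual_add.
Proof. by move=> f g; apply: dual_eqP => x /=; rewrite addrC. Qed.

Lemma dual_add0 : left_id dual_zero dual_add.
Proof. by move=> f; apply: dual_eqP => x /=; rewrite add0r. Qed.

Lemma dual_addN : left_inverse dual_zero dual_opp dual_add.
Proof. by move=> f; apply: dual_eqP => x /=; rewrite addNr. Qed.

HB.instance Definition _ :=
  GRing.isZmodule.Build dual dual_addA dual_addC dual_add0 dual_addN.

Lemma dual_scaleA (a b : K) f :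
  dual_scale a (dual_scale b f) = dual_scale (a * b) f.
Proof. by apply: dual_eqP => x /=; rewrite scalerA. Qed.

Lemma dual_scale1 : left_id 1 dual_scale.
Proof. by move=> f; apply: dual_eqP => x /=; rewrite scale1r. Qed.

Lemma dual_scaleDr : right_distributive dual_scale +%R.
Proof. by move=> a f g; apply: dual_eqP => x /=; rewrite scalerDr. Qed.

Lemma dual_scaleDl f : {morph dual_scale^~ f : a b / a + b}.
Proof. by move=> a b; apply: dual_eqP => x /=; rewrite scalerDl. Qed.

HB.instance Definition _ := GRing.Zmodule_isLmodule.Build K dual
  dual_scaleA dual_scale1 dual_scaleDr dual_scaleDl.

Definition dual_norm f : K :=
  supremum 0 [set `|f x| | x in [set x | `|x| <= 1]].

Lemma dual_norm_lub f :
  isLub [set `|f x| | x in [set x | `|x| <= 1]] (dual_norm f).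
Proof.
set A := [set _ | _ in _].
have A0 : A !=set0 by exists `|f 0|; exists 0 => //=; rewrite normr0.
have Age : A `<=` [set a | 0 <= a] by move=> _ [x _ <-] /=.
have Aub : ubound A !=set0.
  have /linear_bounded_continuous/linear_boundedP/pinfty_ex_gt0[r r0 fr] :
    continuous f := @dual_continuous f.
  exists r => _ [x /= x1 <-]; apply: le_trans (fr x) _.
  by rewrite -[leRHS]mulr1 ler_pM2l.
have [m Am] := scalar_supremums A0 Age Aub.
rewrite /dual_norm /supremum -/A; case: ifPn => [/eqP e0|_].
  by move: A0; rewrite e0 => -[].
by case: xgetP => [y -> [? ?]|/(_ m)/(_ Am)//]; split.
Qed.

Lemma dual_norm_le f (b : K) :
  (forall x, `|x| <= 1 -> `|f x| <= b) -> dual_norm f <= b.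
Proof. by move=> fb; have [_] := dual_norm_lub f; apply=> _ [x /= ? <-]; exact: fb. Qed.

Lemma dual_norm_ge1 f x : `|x| <= 1 -> `|f x| <= dual_norm f.
Proof. by move=> x1; have [h _] := dual_norm_lub f; apply: h; exists x. Qed.

Lemma dual_norm_ge0 f : 0 <= dual_norm f.
Proof. by apply: le_trans (normr_ge0 (f 0)) (dual_norm_ge1 _ _); rewrite normr0. Qed.

Lemma dual_norm_ge f x : `|f x| <= dual_norm f * `|x|.
Proof.
have [->|x0] := eqVneq x 0; first by rewrite linear0 !normr0 mulr0.
have nx0 : 0 < `|x| by rewrite normr_gt0.
have := @dual_norm_ge1 f (`|x|^-1 *: x).
rewrite linearZ/= !normrZ normfV normr_id mulVf ?gt_eqF// => /(_ (lexx _)).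
by rewrite mulrC ler_pdivrMr.
Qed.

Lemma dual_normD f g : dual_norm (f + g) <= dual_norm f + dual_norm g.
Proof.
apply: dual_norm_le => x x1.
by rewrite (le_trans (ler_normD _ _))// lerD ?dual_norm_ge1.
Qed.

Lemma dual_normZ_le (a : K) f : dual_norm (a *: f) <= `|a| * dual_norm f.
Proof.
apply: dual_norm_le => x x1.
by rewrite [X in `|X|]/= normrZ ler_wpM2l ?dual_norm_ge1.
Qed.

Lemma dual_normr0_eq0 f : dual_norm f = 0 -> f = 0.
Proof.
move=> f0; apply: dual_eqP => x /=; apply/eqP.
by rewrite -normr_le0 (le_trans (dual_norm_ge f x))// f0 mul0r.
Qed.

Lemma dual_normZ (a : K) f : dual_norm (a *: f) = `|a| * dual_norm f.
Proof.
apply/eqP; rewrite eq_le dual_normZ_le /=.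
have [->|a0] := eqVneq a 0; first by rewrite normr0 mul0r dual_norm_ge0.
have na0 : 0 < `|a| by rewrite normr_gt0.
rewrite mulrC -ler_pdivlMr// mulrC -normfV.
by have := dual_normZ_le a^-1 (a *: f); rewrite scalerA mulVf// scale1r.
Qed.

HB.instance Definition _ := Lmodule_isNormed.Build K dual
  dual_normD dual_normZ dual_normr0_eq0.

Definition state_space (e : E) : set dual := [set f : dual | `|f| = 1 /\ f e = 1].

(* sigma(E, E^* ), the coarsest topology on E making every functional in E^*
   continuous. *)
Definition weak_topology : Type :=
  initial_topology ((fun (x : E) (f : dual) => f x) : E -> {ptws dual -> K^o}).

HB.instance Definition _ := Topological.copy weak_topology
  (initial_topology ((fun (x : E) (f : dual) => f x) : E -> {ptws dual -> K^o})).

Definition weakly_compact (A : set E) : Prop :=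
  compact (A : set weak_topology).

End Dual.

(* Main.v *)
(* Write P_i for the restriction of functionals to the i-th summand and T_i for
   the composition of functionals with the i-th coordinate; both are adjoints of
   contractions, hence weakly continuous, and P_i T_i = id.

   If S_x is weakly compact and ||x_i|| = 1, then S_(x_i) is the image under P_i
   of the weakly closed face {g in S_x : g(x_i) = 1}.

   Conversely, let Lambda = {i : ||x_i|| = 1}, which is finite, and let g be in
   S_x. Since ||x_i|| is bounded away from 1 off Lambda, x can be perturbed there
   without leaving the unit ball, so g vanishes on the families supported off
   Lambda and g is the sum of the T_i P_i g over Lambda. Replacing the i-th
   coordinate of x by an arbitrary vector of the unit ball gives
   ||P_i g|| = (P_i g)(x_i). Thus S_x is the slice {g(x) = 1} of the finite sum of
   the sets T_i C_i, where C_i = {h : ||h|| <= 1, h(x_i) = ||h||} is the cone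
   [0, 1] S_(x_i), together with 0. *)
From HB Require Import structures.
Require Import Defs.
From mathcomp Require Import all_boot all_order all_algebra.
From mathcomp Require Import all_classical all_reals all_analysis.
From mathcomp Require Import complex.
Import Order.TTheory GRing.Theory Num.Theory.
Import numFieldNormedType.Exports.
Local Open Scope classical_set_scope.
Local Open Scope ring_scope.
Set Implicit Arguments.
Unset Strict Implicit.
Unset Printing Implicit Defensive.

(** * Real and complex scalars *)

Section Scalars.
Context {R : realType} {k : scalar_kind}.
Notation K := (scalar_field R k).

(** Taking real parts gives |a| <= Re a, while |Re a| <= |a|; equality leaves no room for an
    imaginary part. *)
Lemma norm_eq_of_perturbation (a : K) : `|1 - a + `|a| | <= 1 -> a = `|a|.
Proof.
case: k a => /= a.
  rewrite ler_norml => /andP[_ h]; apply/eqP; rewrite eq_le ler_norm /=.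
  by move: h; rewrite -addrA gerDl addrC subr_le0.
have [r ar] : exists r : R, `|a| = r%:C%C by rewrite normc_def; eexists.
have aRe : (`|complex.Re a|%:C)%C <= `|a| := normc_ge_Re a.
have aE : `|a| ^+ 2 = ((complex.Re a) ^+ 2 + (complex.Im a) ^+ 2)%:C%C.
  by rewrite normc_def -rmorphXn sqr_sqrtr ?addr_ge0 ?sqr_ge0.
move=> h1; have := le_trans (normc_ge_Re _) h1.
move: aRe aE; rewrite ar; clear h1 ar.
case: a => u v /=; rewrite lecR => ur.
rewrite -rmorphXn /= => -[r2] /[!lecE] /= /andP[_].
move=> /(le_trans (ler_norm _)) h.
have ru : r = u.
  apply/eqP; rewrite eq_le (le_trans (ler_norm _) ur) andbT.
  by move: h; rewrite -addrA gerDl addrC subr_le0.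
move: r2; rewrite ru -[LHS]addr0 => /addrI/esym/eqP.
by rewrite sqrf_eq0 => /eqP ->.
Qed.

(** In the complex order 0 <= a forces the imaginary part to be 0, so the set is the continuous
    image of the real segment. *)
Lemma scalar_segment_compact : compact [set a : K^o | 0 <= a <= 1].
Proof.
case: k.
  rewrite (_ : mkset _ = `[0, 1]%classic); first exact: (@segment_compact R 0 1).
  by apply/seteqP; split=> a /=; rewrite in_itv.
have c : continuous ((fun r : R => r%:C%C) : R -> (R[i])^o).
  move=> r; apply/cvgrPdist_lt => e e0.
  have : exists2 d : R, 0 < d & e = d%:C%C.
    by case: e e0 => a b; rewrite ltcE /= => /andP[/eqP -> ?]; exists a.
  case=> d d0 ->; near=> s.
  rewrite -rmorphB normc_def /= expr0n addr0 sqrtr_sqr ltcR.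
  by near: s; exact: cvgr_dist_lt.
have -> : [set a : (scalar_field R ComplexScalars)^o | 0 <= a <= 1] =
    (fun r : R => r%:C%C) @` `[0, 1]%classic.
  apply/seteqP; split=> [[a b]|_ [r /= + <-]].
    rewrite /= !lecE /= => /andP[/andP[/eqP -> a0] /andP[_ a1]].
    by exists a => //=; rewrite in_itv /= a0.
  by rewrite in_itv /= !lecR.
apply: continuous_compact; last exact: segment_compact.
exact: continuous_subspaceT.
Unshelve. all: by end_near. Qed.

End Scalars.

(** * Weak continuity and weak compactness *)

Section Weak.
Context {R : realType} {k : scalar_kind}.
Notation K := (scalar_field R k).
Implicit Types E F : normedModType K.

Lemma continuous_of_bound E F (f : E -> F) (M : K) : linear f ->
  0 <= M -> (forall u, `|f u| <= M * `|u|) -> continuous f.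
Proof.
move=> lf M0 fM.
pose g : {linear E -> F} := HB.pack f (GRing.isLinear.Build K E F *:%R f lf).
apply: (@bounded_linear_continuous _ _ _ g); apply/linear_boundedP.
exists M; split; first exact: ger0_real.
by move=> r /ltW Mr u; rewrite (le_trans (fM u))// ler_wpM2r.
Qed.

Lemma weak_eval_continuous E (f : dual E) :
  continuous ((fun u => f u) : weak_topology E -> K^o).
Proof.
move=> u; have h := @initial_continuous _ _
  ((fun (x : E) (f : dual E) => f x) : E -> {ptws dual E -> K^o}) u.
have ff := @fmap_filter _ _ (fun (x : E) (f : dual E) => f x) _ (nbhs_filter u).
exact: (iffLR (pointwise_cvgP _ ff) h f).
Qed.

Lemma continuous_to_weak (T : topologicalType) E (g : T -> weak_topology E) :
  (forall f : dual E, continuous ((fun t => f (g t)) : T -> K^o)) ->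
  continuous g.
Proof.
move=> fg; apply: continuous_comp_initial => t.
by apply/pointwise_cvgP => f; exact: fg.
Qed.

Lemma compact_image2 (T U V : topologicalType) (g : T -> U -> V)
    (A : set T) (B : set U) :
  continuous (fun p : T * U => g p.1 p.2) ->
  compact A -> compact B -> compact [set g a b | a in A & b in B].
Proof.
move=> cg cA cB.
have -> : [set g a b | a in A & b in B] =
    (fun p : T * U => g p.1 p.2) @` (A `*` B).
  apply/seteqP; split=> [_ [a Aa [b Bb <-]]|_ [[a b] [/= Aa Bb] <-]].
    by exists (a, b).
  by exists a => //; exists b.
apply: continuous_compact; last exact: compact_setX.
exact: continuous_subspaceT.
Qed.

Lemma weakly_compact_add E (A B : set E) :
  weakly_compact A -> weakly_compact B ->
  weakly_compact [set a + b | a in A & b in B].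
Proof.
apply: (@compact_image2 (weak_topology E) (weak_topology E) (weak_topology E)
  (fun a b => (a : E) + (b : E))).
apply: continuous_to_weak => f.
under eq_fun do rewrite linearD.
move=> p; apply: cvgD.
  by apply: (cvg_comp _ _ (@cvg_fst _ _ _ _ _)); exact: weak_eval_continuous.
by apply: (cvg_comp _ _ (@cvg_snd _ _ _ _ _)); exact: weak_eval_continuous.
Qed.

Lemma weakly_compact_scale E (A : set E) :
  weakly_compact A ->
  weakly_compact [set a *: u | a in [set a : K | 0 <= a <= 1] & u in A].
Proof.
apply: (@compact_image2 K^o (weak_topology E) (weak_topology E)
  (fun a u => (a : K) *: (u : E))); last exact: scalar_segment_compact.
apply: continuous_to_weak => f.
under eq_fun do rewrite linearZ.
move=> p; apply: cvgM; first exact: cvg_fst.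
by apply: (cvg_comp _ _ (@cvg_snd _ _ _ _ _)); exact: weak_eval_continuous.
Qed.

Section Adjoint.
Variables (E F : normedModType K) (L : E -> F).
Hypotheses (lL : linear L) (cL : forall u, `|L u| <= `|u|).

Definition adjoint (f : dual F) : dual E.
Proof.
exists (fun u => f (L u)) => [a u v|u]; first by rewrite lL linearP.
apply: continuous_comp; last exact: dual_continuous.
by apply: (continuous_of_bound lL ler01) => v; rewrite mul1r.
Defined.

Lemma adjoint_linear : linear adjoint.
Proof. by move=> a f g; apply: dual_eqP. Qed.

Lemma adjoint_le f : `|adjoint f| <= `|f|.
Proof.
apply: dual_norm_le => u u1.
exact: (dual_norm_ge1 f (le_trans (cL u) u1)).
Qed.

(** [L] is weakly continuous: a functional on [F] composed with [L] is its adjoint, a functional on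
    [E]. *)
Lemma weakly_compact_image (A : set E) :
  weakly_compact A -> weakly_compact (L @` A).
Proof.
apply: (@continuous_compact (weak_topology E) (weak_topology F)).
apply: continuous_subspaceT.
apply: (@continuous_to_weak (weak_topology E)) => f.
exact: (@weak_eval_continuous E (adjoint f)).
Qed.

End Adjoint.

Lemma weakly_compact_level E (A : set E) (f : dual E) (a : K) :
  weakly_compact A -> weakly_compact (A `&` [set u | f u = a]).
Proof.
move=> cA; apply: compact_closedI cA _.
rewrite (_ : mkset _ = (fun u => f u : K^o) @^-1` [set a]) //.
apply: closed_comp; first by move=> u _; exact: weak_eval_continuous.
by apply: accessible_closed_set1; apply: hausdorff_accessible; exact: norm_hausdorff.
Qed.

(** The canonical map into the bidual; it makes conditions on the value of a functional at [u]
    weakly closed in the dual. *)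
Definition dual_eval E (u : E) : dual (dual E).
Proof.
exists (fun f : dual E => f u) => //.
apply: (@continuous_of_bound _ _ _ `|u|) => // f.
by rewrite mulrC; exact: dual_norm_ge.
Defined.

(* Containing 0, this set makes it unnecessary to know that the state space is
   nonempty, which would take the Hahn-Banach theorem. *)
Definition norming_cone E (e : E) : set (dual E) :=
  [set h : dual E | `|h| <= 1 /\ h e = `|h|].

Lemma weakly_compact_norming_cone E (e : E) :
  weakly_compact (state_space e) -> weakly_compact (norming_cone e).
Proof.
move=> /weakly_compact_scale cS.
rewrite (_ : norming_cone e =
  [set a *: f | a in [set a : K | 0 <= a <= 1] & f in state_space e]
    `|` [set 0]); last first.
  apply/seteqP; split=> h.
    (* A nonzero [h] of the cone is |h| times the state h / |h|. *)
    case=> h1 he; have [->|h0] := eqVneq h 0; first by right.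
    have nh0 : `|h| != 0 by rewrite normr_eq0.
    left; exists `|h|; first by rewrite /= normr_ge0.
    exists (`|h|^-1 *: h); last by rewrite scalerA divff// scale1r.
    split; first by rewrite normrZ normfV normr_id mulVf.
    by rewrite [LHS](_ : _ = `|h|^-1 * h e)// he mulVf.
  case=> [[a /andP[a0 a1] [f [f1 fe] <-]]|->]; last by split; rewrite normr0.
  split; rewrite normrZ f1 mulr1 ger0_norm//.
  by rewrite [LHS](_ : _ = a * f e)// fe mulr1.
by apply: compactU cS _; exact: compact_set1.
Qed.

End Weak.

(** Multiplying a vector by such a [c] keeps its norm and turns the value of a functional there into
    its modulus. *)
Lemma exists_rotation (K : numFieldType) (a : K) :
  exists2 c : K, `|c| = 1 & c * a = `|a|.
Proof.
have [->|a0] := eqVneq a 0; first by exists 1; rewrite ?normr1// mulr0 normr0.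
exists (`|a| / a); last by rewrite divfK.
by rewrite normrM normfV normr_id divff// normr_eq0.
Qed.

(** * Coordinates of the c0-sum *)

Section C0Coordinates.
Context {K : numFieldType} {J : Type} (X : J -> completeNormedModType K).

(** The type [X j] depends on the index, so [u] is transported along a proof of [i = j], decided
    classically. *)
Definition single (i : J) (u : X i) (j : J) : X j :=
  if pselect (i = j) is left e then eq_rect i X u j e else 0.

Lemma single_eq i (u : X i) : single u i = u.
Proof.
rewrite /single; case: pselect => // e.
by rewrite (Prop_irrelevance e (erefl i)).
Qed.

Lemma single_ne i j (u : X i) : i <> j -> single u j = 0.
Proof. by rewrite /single; case: pselect. Qed.

Lemma vanishing_single i (u : X i) : vanishing (single u).
Proof.
move=> e e0; apply: (@sub_finite_set _ _ [set i]) => // j /= ej.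
apply: contrapT => /nesym ij; move: ej.
by rewrite single_ne// normr0 lt_geF.
Qed.

Definition c0_single i (u : X i) : c0_sum X := C0Sum (vanishing_single u).

Lemma c0_single_linear i : linear (@c0_single i).
Proof.
move=> a u v; apply: c0_eqP => j /=.
have [ij|ij] := pselect (i = j); first by subst j; rewrite !single_eq.
by rewrite !single_ne// scaler0 addr0.
Qed.

Lemma c0_single_le i (u : X i) : `|c0_single u| <= `|u|.
Proof.
apply: c0_norm_le => // j /=.
have [ij|ij] := pselect (i = j); first by subst j; rewrite single_eq.
by rewrite single_ne// normr0.
Qed.

Definition c0_coord i (y : c0_sum X) : X i := y i.

Lemma c0_coord_linear i : linear (@c0_coord i).
Proof. by []. Qed.

Lemma c0_coord_le i (y : c0_sum X) : `|c0_coord i y| <= `|y|.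
Proof. exact: c0_norm_ge. Qed.

(** [{classic J}] supplies decidable equality on indices; [uniq s] keeps a coordinate from being
    added twice. *)
Lemma c0_sum_single (s : seq {classic J}) (y : c0_sum X) j : uniq s ->
  (\sum_(i <- s) c0_single (y i) : c0_sum X) j =
    if (j : {classic J}) \in s then y j else 0.
Proof.
elim: s => [|a s ih] /=; first by rewrite big_nil.
move=> /andP[sa us]; rewrite big_cons in_cons.
rewrite [LHS](_ : _ = single (y a) j +
  (\sum_(i <- s) c0_single (y i) : c0_sum X) j)// ih//.
have [ja|/eqP ja] := eqVneq (j : {classic J}) a.
  by subst j; rewrite single_eq (negbTE sa) addr0.
by rewrite single_ne ?add0r//; exact: nesym.
Qed.

(** Only finitely many coordinates have norm at least 1/2; [r] is the maximum of 1/2 and those of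
    their norms that are not 1. *)
Lemma c0_norm_gap (x : c0_sum X) : `|x| = 1 ->
  exists2 r : K, 0 <= r < 1 & forall i, `|x i| <> 1 -> `|x i| <= r.
Proof.
move=> x1; have x_le i : `|x i| <= 1 by rewrite -x1; exact: c0_norm_ge.
have h0 : 0 < 2^-1 :> K by rewrite invr_gt0.
have /finite_seqP[s sE] : finite_set ([set i | 2^-1 <= `|x i|] : set {classic J}).
  exact: c0_vanishing.
have [r r12 rs] : exists2 r : K, 2^-1 <= r < 1 &
    forall i, i \in s -> `|x i| <> 1 -> `|x i| <= r.
  elim: {sE}s => [|a s [r /andP[r2 r1] rs]].
    by exists 2^-1 => //; rewrite lexx invf_lt1// ltr1n.
  have rr : r \is Num.real by apply: ger0_real; exact: le_trans (ltW h0) r2.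
  have [ar|ra] := real_leP (normr_real (x a)) rr.
    by exists r; rewrite ?r2// => i; rewrite in_cons => /predU1P[->//|/rs].
  have [xa|/eqP xa] := pselect (`|x a| = 1).
    by exists r; rewrite ?r2// => i; rewrite in_cons => /predU1P[->//|/rs].
  exists `|x a|; first by rewrite (le_trans r2 (ltW ra)) lt_neqAle xa x_le.
  move=> i; rewrite in_cons => /predU1P[->//|/rs h /h].
  by move=> /le_trans; apply; exact: ltW.
have /andP[r2 r1] := r12.
exists r; first by rewrite (le_trans (ltW h0) r2).
move=> i xi; have [|ri] := real_leP (normr_real (x i)) (gtr0_real h0).
  by move=> /le_trans; apply.
apply: rs => //; have : [set` s] i by rewrite -sE /=; exact: ltW.
by [].
Qed.

End C0Coordinates.

(** * Functionals on the c0-sum *)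

Section C0Dual.
Context {R : realType} {k : scalar_kind} {J : Type}.
Notation K := (scalar_field R k).
Variable X : J -> completeNormedModType K.
Implicit Types (x y : c0_sum X) (g : dual (c0_sum X)).
Implicit Types (s : seq {classic J}).

(** This is T_i; [dual_restr] is P_i. *)
Definition dual_incl i : dual (X i) -> dual (c0_sum X) :=
  adjoint (@c0_coord_linear K J X i) (@c0_coord_le K J X i).

Definition dual_restr i : dual (c0_sum X) -> dual (X i) :=
  adjoint (@c0_single_linear K J X i) (@c0_single_le K J X i).

Lemma dual_inclK i : cancel (@dual_incl i) (@dual_restr i).
Proof. by move=> f; apply: dual_eqP => u /=; rewrite /c0_coord/= single_eq. Qed.

(** Both adjoints are contractions, so norms stay at most 1, and the value 1 at a unit vector forces
    norm at least 1. *)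
Lemma state_space_restr x i : `|x| = 1 -> `|x i| = 1 ->
  state_space (x i) = @dual_restr i @`
    (state_space x `&` [set g | dual_eval (c0_single (x i)) g = 1]).
Proof.
move=> x1 xi1; apply/seteqP; split=> [f [f1 fxi]|_ [g [[g1 _] gxi] <-]].
  exists (dual_incl f); last exact: dual_inclK.
  split; last by rewrite /= /c0_coord/= single_eq.
  split=> //; apply/eqP; rewrite eq_le -{1}f1 adjoint_le/=.
  by have := dual_norm_ge (dual_incl f) x; rewrite [_ x]fxi normr1 x1 mulr1.
split; last exact: gxi.
apply/eqP; rewrite eq_le -{1}g1 adjoint_le/=.
have := dual_norm_ge (dual_restr i g) (x i).
by rewrite [_ (x i)]gxi normr1 xi1 mulr1.
Qed.

(** The Minkowski sum of the T_i C_i, as a fold so that its properties follow by induction on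
    [s]. *)
Definition cone_sum x (s : seq {classic J}) : set (dual (c0_sum X)) :=
  foldr
    (fun i B => [set f + g | f in @dual_incl i @` norming_cone (x i) & g in B])
    [set 0] s.

Lemma weakly_compact_cone_sum x (s : seq {classic J}) :
  (forall i, i \in s -> weakly_compact (state_space (x i))) ->
  weakly_compact (cone_sum x s).
Proof.
elim: s => [|i s ih] cS; first exact: compact_set1.
apply: weakly_compact_add.
  apply: (weakly_compact_image (adjoint_linear _ _) (@adjoint_le _ _ _ _ _ _ _)).
  by apply: weakly_compact_norming_cone; apply: cS; rewrite mem_head.
by apply: ih => j js; apply: cS; rewrite in_cons js orbT.
Qed.

(** On each summand |T_i f| <= |f| = f(x_i) = (T_i f)(x); the triangle inequality adds these up. *)
Lemma cone_sum_norm_le x s g : cone_sum x s g -> `|g| <= g x.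
Proof.
elim: s g => [|i s ih] g /=; first by move=> ->; rewrite normr0.
case=> _ [f [_ fxi] <-] [h /ih hx <-].
apply: le_trans (ler_normD _ _) _.
rewrite [leRHS](_ : _ = f (x i) + h x)// lerD// fxi.
exact: adjoint_le.
Qed.

Lemma cone_sum_restr x s g :
  (forall i, i \in s -> norming_cone (x i) (dual_restr i g)) ->
  cone_sum x s (\sum_(i <- s) dual_incl (dual_restr i g)).
Proof.
elim: s => [|i s ih] hs; first by rewrite big_nil.
rewrite big_cons; exists (dual_incl (dual_restr i g)).
  by exists (dual_restr i g) => //; apply: hs; rewrite mem_head.
by eexists; first by apply: ih => j js; apply: hs; rewrite in_cons js orbT.
Qed.

Lemma sum_dual_restr (s : seq {classic J}) g y :
  (\sum_(i <- s) dual_incl (dual_restr i g) : dual (c0_sum X)) y =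
  g (\sum_(i <- s) c0_single (y i)).
Proof.
elim: s => [|i s ih]; first by rewrite !big_nil linear0.
rewrite !big_cons linearD.
exact: (congr1 (fun z => g (c0_single (y i)) + z) ih).
Qed.

Lemma state_space_norm_le x g y : state_space x g -> `|y| <= 1 -> `|g y| <= 1.
Proof. by move=> [g1 _] y1; rewrite -g1; exact: dual_norm_ge1. Qed.

Lemma state_space_restr_cone x g i : `|x| = 1 -> state_space x g ->
  norming_cone (x i) (dual_restr i g).
Proof.
move=> x1 gS; have [g1 gx] := gS; set h := dual_restr i g.
have xi1 : `|x i| <= 1 by rewrite -x1; exact: c0_norm_ge.
(* The family tested is [x] with its i-th coordinate replaced by [u], still in the unit ball. *)
have perturb u : `|u| <= 1 -> `|1 - h (x i) + h u| <= 1.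
  move=> u1; rewrite -{1}gx [X in `|X|](_ : _ =
    g (x - c0_single (x i) + c0_single u)); last by rewrite linearD linearB.
  apply: (state_space_norm_le gS); apply: c0_norm_le => // j.
  rewrite [X in `|X|](_ : _ = x j - single (x i) j + single u j)//.
  have [ij|ij] := pselect (i = j).
    by subst j; rewrite !single_eq subrr add0r.
  by rewrite !single_ne// subr0 addr0 -x1; exact: c0_norm_ge.
have hxi : h (x i) = `|h (x i)|.
  apply: norm_eq_of_perturbation.
  have [c c1 <-] := exists_rotation (h (x i)).
  rewrite [X in _ + X](_ : _ = h (c *: x i)); last by rewrite linearZ.
  by apply: perturb; rewrite normrZ c1 mul1r.
have h_le : `|h| <= h (x i).
  (* Rotating [u] gives 1 - h(x_i) + |h u| <= 1, where h(x_i) is already known to be real. *)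
  apply: dual_norm_le => u u1; have [c c1 hu] := exists_rotation (h u).
  have := perturb (c *: u); rewrite normrZ c1 mul1r => /(_ u1).
  rewrite [h (c *: u)](_ : _ = `|h u|); last by rewrite -hu linearZ.
  rewrite hxi => le1.
  have re : 1 - `|h (x i)| + `|h u| \is Num.real.
    by apply: rpredD; [apply: rpredB|]; rewrite ?rpred1 ?normr_real.
  have := le_trans (real_ler_norm re) le1.
  by rewrite -addrA gerDl addrC subr_le0.
split; first by rewrite -g1; exact: adjoint_le.
apply/eqP; rewrite eq_le h_le andbT hxi.
apply: le_trans (dual_norm_ge h (x i)) _.
by rewrite -[leRHS]mulr1 ler_wpM2l//; exact: dual_norm_ge0.
Qed.

Lemma state_space_vanish x g y : `|x| = 1 -> state_space x g ->
  (forall i, `|x i| = 1 -> y i = 0) -> g y = 0.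
Proof.
move=> x1 gS y0; have [_ gx] := gS.
have [r /andP[r0 r1] xr] := c0_norm_gap x1.
have [c c1 cg] := exists_rotation (g y).
have y1 : 0 < 1 + `|y| by rewrite ltr_pwDl.
(* Chosen so that r + t |y_i| <= 1 for every i; the added 1 keeps the denominator positive when y =
   0. The bound below then reads 1 + t |g y| <= 1. *)
pose t := (1 - r) / (1 + `|y|).
have t0 : 0 < t by rewrite divr_gt0// subr_gt0.
have : `|g (x + (t * c) *: y)| <= 1.
  apply: (state_space_norm_le gS); apply: c0_norm_le => // i.
  rewrite [X in `|X|](_ : _ = x i + (t * c) *: y i)//.
  have [xi|xi] := pselect (`|x i| = 1).
    by rewrite y0// scaler0 addr0 xi.
  apply: le_trans (ler_normD _ _) _.
  rewrite normrZ normrM c1 mulr1 (gtr0_norm t0).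
  rewrite -[leRHS](subrK r) addrC lerD ?xr//.
  rewrite /t -mulrA ler_piMr ?subr_ge0 ?(ltW r1)//.
  rewrite mulrC ler_pdivrMr// mul1r (le_trans (c0_norm_ge y i))//.
  by rewrite lerDr.
rewrite [g _](_ : _ = 1 + t * `|g y|); last first.
  by rewrite linearD linearZ -cg mulrA -gx.
rewrite ger0_norm; last by rewrite addr_ge0// mulr_ge0// ltW.
by rewrite gerDl pmulr_rle0// normr_le0 => /eqP.
Qed.

Lemma state_spaceE x (s : seq {classic J}) : `|x| = 1 ->
  uniq s -> (forall i, i \in s <-> `|x i| = 1) ->
  state_space x = cone_sum x s `&` [set g | dual_eval x g = 1].
Proof.
move=> x1 us sE; apply/seteqP; split=> [g gS|g [gC gx]].
  have [g1 gx] := gS; split=> //.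
  have -> : g = \sum_(i <- s) dual_incl (dual_restr i g).
    apply: dual_eqP => y; rewrite sum_dual_restr.
    apply/eqP; rewrite -subr_eq0 -linearB; apply/eqP.
    (* Subtracting from [y] its coordinates in [s] leaves a family that is zero on Lambda. *)
    apply: (state_space_vanish x1 gS) => i /sE si.
    rewrite [LHS](_ : _ = y i - (\sum_(i <- s) c0_single (y i) : c0_sum X) i)//.
    by rewrite c0_sum_single// si subrr.
  by apply: cone_sum_restr => i _; exact: state_space_restr_cone.
split=> //; apply/eqP; rewrite eq_le.
(* The slice condition turns |g| <= g(x) into |g| <= 1; the reverse bound is |g(x)| <= |g| |x|. *)
rewrite -{1}[1]gx (cone_sum_norm_le gC)/=.
by have := dual_norm_ge g x; rewrite [g x]gx normr1 x1 mulr1.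
Qed.

End C0Dual.

Theorem theorem3p12 (R : realType) (k : scalar_kind) (J : Type)
    (X : J -> completeNormedModType (scalar_field R k)) (x : c0_sum X)
    (hx : `|x| = 1) :
  weakly_compact (state_space x) <->
  forall i : J, [set j | `|x j| = 1] i -> weakly_compact (state_space (x i)).
Proof.
split=> [cS i /= xi1|cS].
  rewrite (state_space_restr hx xi1).
  apply: (weakly_compact_image (adjoint_linear _ _) (@adjoint_le _ _ _ _ _ _ _)).
  exact: weakly_compact_level.
(* Lambda lies in the set of j with 1 <= |x_j|, finite because [x] vanishes at infinity. *)
have /finite_seqP[s sE] : finite_set ([set j | `|x j| = 1] : set {classic J}).
  by apply: sub_finite_set (c0_vanishing x ltr01) => j /= ->.
have sx i : i \in undup s <-> `|x i| = 1.
  rewrite mem_undup; have -> : (`|x i| = 1) = [set j | `|x j| = 1] i by [].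
  by rewrite sE.
rewrite (state_spaceE hx (undup_uniq s) sx).
apply: weakly_compact_level; apply: weakly_compact_cone_sum => i /sx.
exact: cS.
Qed.
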